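(* Let $a(N)$ denote the number of Rascoe partitions of $N$ (partitions of $N$ into distinct parts in which the number of parts is itself a part), and let $b(N)$ denote the number of non-Rascoe partitions of $N$ (partitions of $N$ into distinct parts in which the number of parts is not a part). Then \begin{align*} \textup{(i)}\quad \sum_{N=1}^{\infty} a(N) q^N &= \sum_{n=1}^{\infty} q^{n(n+1)/2} \sum_{m=1}^{n} \left[\begin{matrix} n-1\\ m-1\end{matrix}\right]_q\frac{q^{m(m-1)}}{(q;q)_{m-1}},\\ \textup{(ii)}\quad \sum_{N=1}^{\infty} b(N) q^N &= \sum_{n=1}^{\infty} q^{n(n+1)/2} \sum_{m=1}^{n} \left[\begin{matrix} n-1\\ m-1\end{matrix}\right]_q \frac{q^{m^2}}{(q;q)_m}. \end{align*}
   Context: Here $|q|<1$, $(a;q)_0=1$, $(a;q)_n=(1-a)(1-aq)\cdots(1-aq^{n-1})$, and the Gaussian polynomial is $\left[\begin{matrix} N\\ n\end{matrix}\right]_q=\frac{(q;q)_N}{(q;q)_n(q;q)_{N-n}}$ if $0\le n\le N$ and $0$ otherwise. *)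

(* Defs.v *)
From HB Require Import structures.
From mathcomp Require Import all_boot all_order all_algebra.
From mathcomp Require Import all_classical all_reals all_analysis.
From mathcomp Require Import complex.
Set Implicit Arguments.
Unset Strict Implicit.
Unset Printing Implicit Defensive.
Import Order.TTheory GRing.Theory Num.Theory.
Import numFieldNormedType.Exports.
Local Open Scope classical_set_scope.
Local Open Scope ring_scope.

Definition qpoch (F : fieldType) (a q : F) (n : nat) : F :=
  \prod_(0 <= i < n) (1 - a * q ^+ i).

Definition gauss_binom (F : fieldType) (q : F) (N n : nat) : F :=
  if (n <= N)%N then qpoch q q N / (qpoch q q n * qpoch q q (N - n)) else 0.

(* A partition of [N] into distinct parts is identified with the set of its
   parts, all of which are at most [N]. *)
Definition distinct_partitions (N : nat) : {set {set 'I_N.+1}} :=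
  [set A : {set 'I_N.+1} |
    (ord0 \notin A) && ((\sum_(i in A) (i : nat))%N == N)].

Definition is_rascoe (N : nat) (A : {set 'I_N.+1}) : bool :=
  [exists i in A, (i : nat) == #|A|].

Definition num_rascoe (N : nat) : nat :=
  #|[set A in distinct_partitions N | is_rascoe A]|.

Definition num_nonrascoe (N : nat) : nat :=
  #|[set A in distinct_partitions N | ~~ is_rascoe A]|.

(* The series [f 1 + f 2 + ...] converges, with sum [s], for the topology that
   the norm induces on [K]. *)
Definition sums_from1_to (K : numFieldType) (f : nat -> K) (s : K) : Prop :=
  (fun M : nat => \sum_(1 <= n < M.+1) f n) @ \oo --> s.

(* Main.v *)
(* A partition into n distinct parts, one of which is n, consists of n - m parts
   below n, the part n and m - 1 parts above n; if n is not a part, it consists of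
   n - m parts below n and m parts above n.  By the q-binomial theorem, the smaller
   parts contribute a Gaussian polynomial with upper index n - 1 and the larger
   ones, when bounded by L, a Gaussian polynomial with upper index L - n, which
   tends to 1/(q;q)_(m-1) or 1/(q;q)_m as L grows.  So the n-th term of the right
   hand side is the generating function of the partitions with n parts.

   The rearrangement is controlled by one tail bound.  Let S_K be the sum of q^|A|
   over the relevant sets A of parts contained in {1..K}.  A sum over any larger
   collection of sets contained in {1..L} differs from S_K by at most G_L - G_K,
   where G_K = prod_(1 <= i <= K) (1 + |q|^i) converges.  The partial sums of both
   series are (limits of) such sums, for the collections "weight <= M" and "at most
   M parts", so all three sequences have the same limit. *)
Require Import Defs.
From HB Require Import structures.
From mathcomp Require Import all_boot all_order all_algebra.
From mathcomp Require Import all_classical all_reals all_analysis.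
From mathcomp Require Import complex.
From mathcomp Require Import ring zify.
Set Implicit Arguments.
Unset Strict Implicit.
Unset Printing Implicit Defensive.
Import Order.TTheory GRing.Theory Num.Theory.
Import numFieldNormedType.Exports.
Local Open Scope ring_scope.

(** * The q-binomial theorem *)

Section QBinomial.

Variables (F : fieldType) (q : F).
Hypothesis q_not_root : forall i, q ^+ i.+1 != 1.

Lemma qpochS (a : F) n : qpoch a q n.+1 = qpoch a q n * (1 - a * q ^+ n).
Proof. by rewrite /qpoch big_nat_recr. Qed.

Lemma qpoch0 (a : F) : qpoch a q 0 = 1.
Proof. by rewrite /qpoch big_geq. Qed.

Lemma qpoch_neq0 n : qpoch q q n != 0.
Proof.
elim: n => [|n IHn]; first by rewrite qpoch0 oner_eq0.
by rewrite qpochS mulf_neq0 // subr_eq0 -exprS eq_sym.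
Qed.

Lemma gauss_binom_small N n : (N < n)%N -> gauss_binom q N n = 0.
Proof. by move=> ltNn; rewrite /gauss_binom leqNgt ltNn. Qed.

Lemma gauss_binom0 N : gauss_binom q N 0 = 1.
Proof.
by rewrite /gauss_binom leq0n subn0 qpoch0 mul1r divff ?qpoch_neq0.
Qed.

Lemma gauss_binomC N n : (n <= N)%N ->
  gauss_binom q N (N - n) = gauss_binom q N n.
Proof.
by move=> lenN; rewrite /gauss_binom lenN leq_subr subKn // [X in _ / X]mulrC.
Qed.

Lemma gauss_binomnn N : gauss_binom q N N = 1.
Proof. by rewrite -[X in gauss_binom q N X]subn0 gauss_binomC ?gauss_binom0. Qed.

(** The q-Pascal rule: over a common denominator, with [u = q^(n+1)] and [v = q^(N-n)], it reduces
    to [1 - u v = (1 - v) + v (1 - u)]. *)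
Lemma gauss_binomS N n : (n <= N)%N ->
  gauss_binom q N.+1 n.+1
  = gauss_binom q N n.+1 + q ^+ (N - n) * gauss_binom q N n.
Proof.
rewrite leq_eqVlt => /predU1P[->|ltnN].
  by rewrite !gauss_binomnn gauss_binom_small // subnn expr0 add0r mulr1.
rewrite -(subnKC ltnN); set p := (N - n.+1)%N.
rewrite addSnnS /gauss_binom ltnS !leq_addr -addSnnS leq_addr addSnnS.
have -> : (n + p.+1 - n = p.+1)%N by lia.
have -> : ((n + p.+1).+1 - n.+1 = p.+1)%N by lia.
have -> : (n + p.+1 - n.+1 = p)%N by lia.
rewrite !qpochS -!exprS.
have nz i : 1 - q ^+ i.+1 != 0 by rewrite subr_eq0 eq_sym.
have -> : q ^+ (n + p.+1).+1 = q ^+ n.+1 * q ^+ p.+1 by rewrite -exprD addSn.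
move: (nz n) (nz p) (qpoch_neq0 n) (qpoch_neq0 p).
move: (q ^+ n.+1) (q ^+ p.+1) => u v *.
by field; repeat (apply/andP; split).
Qed.

(** The finite q-binomial theorem, by induction on [L] with the q-Pascal rule. The shift [a] will be
    1 for the parts below [n] and [n + 1] for those above. *)
Lemma coef_prod_1Dqexp a L k :
  (\prod_(0 <= i < L) (1 + (q ^+ (i + a)) *: 'X) : {poly F})`_k
  = q ^+ (a * k + 'C(k, 2)) * gauss_binom q L k.
Proof.
elim: L k => [|L IHL] k.
  rewrite big_geq // coef1; case: k => [|k].
    by rewrite muln0 bin0n expr0 gauss_binom0 mulr1.
  by rewrite gauss_binom_small // mulr0.
rewrite big_nat_recr //= mulrDr mulr1 -scalerAr coefD coefZ coefMX !IHL.
case: k => [|k] /=; first by rewrite !gauss_binom0 mulr0 addr0.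
have [lekL|ltLk] := leqP k L; last first.
  by rewrite !gauss_binom_small ?mulr0 ?addr0 //; lia.
rewrite gauss_binomS // mulrDr; congr (_ + _).
rewrite !mulrA -!exprD binS bin1; congr (q ^+ _ * _); lia.
Qed.

End QBinomial.

(** * Sets of parts *)

Section PartitionSets.

Implicit Types (b : bool).

Definition weight n (A : {set 'I_n}) : nat := (\sum_(i in A) i)%N.

(* Rascoe partitions for [b = true], non-empty non-Rascoe ones for [b = false]. *)
Definition admissible b N (A : {set 'I_N.+1}) : bool :=
  [&& ord0 \notin A, (0 < #|A|)%N & is_rascoe A == b].

Definition num_parts b N : nat :=
  #|[set A in distinct_partitions N | is_rascoe A == b]|.

Definition parts_le K n (A : {set 'I_n}) : bool := [forall i in A, i <= K]%N.

Lemma part_neq0 N (A : {set 'I_N.+1}) i : ord0 \notin A -> i \in A -> i != 0%N :> nat.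
Proof.
by move=> A0 iA; apply: contraNneq A0 => i0; rewrite (_ : ord0 = i) //; apply: val_inj.
Qed.

Lemma weight_gt0 b N (A : {set 'I_N.+1}) : admissible b A -> (0 < weight A)%N.
Proof.
case/and3P=> A0 /card_gt0P[i iA] _; rewrite /weight (bigD1 i) //= addn_gt0 lt0n.
by rewrite (part_neq0 A0).
Qed.

Lemma card_admissible_gt0 b N (A : {set 'I_N.+1}) :
  admissible b A -> (0 < #|A|)%N.
Proof. by case/and3P. Qed.

Section Widen.

Variables (K L : nat) (leKL : (K <= L)%N).
Let w : 'I_K.+1 -> 'I_L.+1 := widen_ord (leKL : K.+1 <= L.+1)%N.

Lemma widen_part_inj : injective w.
Proof. by move=> i j /(congr1 val) /= /val_inj. Qed.

Lemma weight_widen (A : {set 'I_K.+1}) : weight (w @: A) = weight A.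
Proof. by rewrite /weight big_imset //= => i j _ _; apply: widen_part_inj. Qed.

Lemma card_widen (A : {set 'I_K.+1}) : #|w @: A| = #|A|.
Proof. exact/card_imset/widen_part_inj. Qed.

Lemma ord0_widen (A : {set 'I_K.+1}) : (ord0 \in w @: A) = (ord0 \in A).
Proof.
have <- : w ord0 = ord0 by apply: val_inj.
by rewrite mem_imset //; apply: widen_part_inj.
Qed.

Lemma is_rascoe_widen (A : {set 'I_K.+1}) : is_rascoe (w @: A) = is_rascoe A.
Proof.
rewrite /is_rascoe card_widen; apply/exists_inP/exists_inP.
  by case=> _ /imsetP[i iA ->] /= iE; exists i.
by case=> i iA iE; exists (w i); rewrite ?imset_f.
Qed.

Lemma admissible_widen b (A : {set 'I_K.+1}) :
  admissible b (w @: A) = admissible b A.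
Proof. by rewrite /admissible ord0_widen is_rascoe_widen card_widen. Qed.

Lemma widen_setK (J : {set 'I_L.+1}) : parts_le K J -> w @: (w @^-1: J) = J.
Proof.
move=> /forall_inP JK; apply/setP => j; apply/imsetP/idP => [[k] | jJ].
  by rewrite inE => kJ ->.
have jK : (j < K.+1)%N by rewrite ltnS JK.
have wE : w (Ordinal jK) = j by apply: val_inj.
by exists (Ordinal jK); rewrite // inE wE.
Qed.

Lemma parts_le_widen (A : {set 'I_K.+1}) : parts_le K (w @: A).
Proof. by apply/forall_inP => _ /imsetP[i _ ->] /=; rewrite -ltnS. Qed.

(** Image under [w] is a bijection onto the sets with all elements at most [K], with preimage as
    inverse; sums for different bounds become comparable. *)
Lemma big_widen (T : Type) (idx : T) (op : Monoid.com_law idx)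
    (P : pred {set 'I_L.+1}) (F : {set 'I_L.+1} -> T) :
  \big[op/idx]_(A : {set 'I_K.+1} | P (w @: A)) F (w @: A)
  = \big[op/idx]_(J : {set 'I_L.+1} | P J && parts_le K J) F J.
Proof.
rewrite [RHS](reindex_onto (fun A : {set _} => w @: A)
                          (fun J : {set _} => w @^-1: J)).
  apply: eq_bigl => A; rewrite parts_le_widen andbT.
  suff -> : w @^-1: (w @: A) == A by rewrite andbT.
  by apply/eqP/setP => i; rewrite inE mem_imset //; apply: widen_part_inj.
by move=> J /andP[_]; apply: widen_setK.
Qed.

Lemma card_parts_le (J : {set 'I_L.+1}) :
  ord0 \notin J -> parts_le K J -> (#|J| <= K)%N.
Proof.
move=> J0 /widen_setK JE; rewrite -JE card_widen.
apply: (@leq_trans #|[set~ ord0 : 'I_K.+1]%SET|).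
  apply: subset_leq_card; apply/fintype.subsetP => i iJ; rewrite !inE.
  by apply: contraNneq J0 => i0; rewrite -JE ord0_widen -i0.
by rewrite cardsC1 card_ord.
Qed.

(** A crude bound suffices: it makes the condition [weight A <= L] eventually capture every set of
    parts up to [K]. *)
Lemma weight_parts_le (J : {set 'I_L.+1}) :
  ord0 \notin J -> parts_le K J -> (weight J <= K * K)%N.
Proof.
move=> J0 JK; apply: leq_trans (_ : \sum_(i in J) K <= _)%N.
  by apply: leq_sum => i; apply/forall_inP: i.
by rewrite sum_nat_const leq_mul2r card_parts_le ?orbT.
Qed.

End Widen.

(** No part exceeds the total, so the partitions of all [N <= M] can be counted inside the single
    type [{set 'I_M.+1}]. *)
Lemma num_partsE b N M : (0 < N <= M)%N ->
  num_parts b N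
  = #|[pred J : {set 'I_M.+1} | admissible b J && (weight J == N)]|.
Proof.
case/andP=> N0 leNM; rewrite /num_parts -!sum1_card.
pose P (J : {set 'I_M.+1}) := admissible b J && (weight J == N).
rewrite [RHS](_ : _ = \sum_(J : {set 'I_M.+1} | P J && parts_le N J) 1)%N.
  rewrite -(big_widen leNM _ P); apply: eq_bigl => A.
  rewrite /P admissible_widen weight_widen !inE /admissible /weight.
  (* The empty set has weight 0, so [N > 0] accounts for the non-emptiness built into
     [admissible]. *)
  case: (posnP #|A|) => [/cards0_eq->|_]; last first.
    by case: (_ \notin _); rewrite //= andbC.
  by rewrite big_set0 (ltn_eqF N0) !andbF.
apply: eq_bigl => J; rewrite inE /P; apply/idP/idP => [/andP[adJ /eqP wJ]|/andP[]//].
rewrite adJ wJ eqxx /=; apply/forall_inP => i iJ.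
by rewrite -wJ /weight (bigD1 i) //= leq_addr.
Qed.

(** Serves for grouping by weight and by number of parts; positivity of [f] matches the outer sum
    starting at 1. *)
Lemma sum_by_statistic (V : nmodType) (I : finType) (P : pred I) (f : I -> nat)
    (F : I -> V) M :
  (forall i, P i -> (0 < f i)%N) ->
  \sum_(1 <= n < M.+1) \sum_(i | P i && (f i == n)) F i
  = \sum_(i | P i && (f i <= M)%N) F i.
Proof.
move=> f0; rewrite (exchange_big_dep P) /=; last by move=> n i _ /andP[].
rewrite big_mkcondr /=; apply: eq_bigr => i Pi.
rewrite Pi /=; under eq_bigl do rewrite eq_sym.
by rewrite (big_nat1_eq _ (fun=> F i)) f0 //= ltnS.
Qed.

End PartitionSets.

(** * Generating functions over bounded sets of parts *)

Section PartialSums.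

Variables (F : fieldType) (q : F).
Implicit Type b : bool.

Definition rascoe_psum b N : F :=
  \sum_(A : {set 'I_N.+1} | admissible b A) q ^+ weight A.

Definition card_psum b L n : F :=
  \sum_(A : {set 'I_L.+1} | admissible b A && (#|A| == n)) q ^+ weight A.

(** Taken at [|q|], this is the majorant [G_N] of the tail bound; the empty set is included so that
    it factors as a product. *)
Definition distinct_psum N : F :=
  \sum_(A : {set 'I_N.+1} | ord0 \notin A) q ^+ weight A.

Lemma num_parts_psum b M :
  \sum_(1 <= N < M.+1) (num_parts b N)%:R * q ^+ N
  = \sum_(A : {set 'I_M.+1} | admissible b A && (weight A <= M)%N) q ^+ weight A.
Proof.
rewrite -sum_by_statistic; last exact: weight_gt0.
apply: eq_big_nat => N NM; rewrite (num_partsE _ NM).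
rewrite (eq_bigr (fun=> q ^+ N)) => [|A /andP[_ /eqP->] //].
by rewrite sumr_const mulr_natl.
Qed.

Lemma card_psum_sum b L M :
  \sum_(1 <= n < M.+1) card_psum b L n
  = \sum_(A : {set 'I_L.+1} | admissible b A && (#|A| <= M)%N) q ^+ weight A.
Proof. by rewrite -sum_by_statistic //; apply: card_admissible_gt0. Qed.

Lemma rascoe_psum_widen b M L : (M <= L)%N ->
  rascoe_psum b M
  = \sum_(A : {set 'I_L.+1} | admissible b A && parts_le M A) q ^+ weight A.
Proof.
move=> leML; rewrite -(big_widen leML _ (@admissible b L)).
by apply: eq_big => A; rewrite ?admissible_widen // weight_widen.
Qed.

Lemma distinct_psum_widen M L : (M <= L)%N ->
  distinct_psum M
  = \sum_(A : {set 'I_L.+1} | (ord0 \notin A) && parts_le M A) q ^+ weight A.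
Proof.
move=> leML; rewrite -(big_widen leML _ (fun A => ord0 \notin A)).
by apply: eq_big => A; rewrite ?ord0_widen // weight_widen.
Qed.

Lemma distinct_psum_prod N : distinct_psum N = \prod_(i < N) (1 + q ^+ i.+1).
Proof.
(* The factor at index 0 equals 1; written this way, its expansion kills every subset containing
   0. *)
transitivity (\prod_(i < N.+1) ((i != 0%N :> nat)%:R * q ^+ i + 1)); last first.
  rewrite big_ord_recl mul0r add0r mul1r; apply: eq_bigr => i _.
  by rewrite mul1r addrC.
rewrite bigA_distr /distinct_psum big_mkcond /=; apply: eq_bigr => A _.
have [A0|A0] := boolP (ord0 \in A); first by rewrite (bigD1 ord0) // A0 /= !mul0r.
rewrite /weight expr_sum big_mkcond; apply: eq_bigr => k _.
by have [kA|//] := boolP (k \in A); rewrite (part_neq0 A0) ?mul1r.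
Qed.

End PartialSums.

(** Sets with all parts at most [M] cancel. Each remaining set contributes at most [|q|^weight] in
    norm, and dropping admissibility only enlarges the bound. *)
Lemma rascoe_psum_dist (K : numFieldType) (q : K) b M L (U : pred {set 'I_L.+1}) :
  (M <= L)%N ->
  (forall A : {set 'I_L.+1}, ord0 \notin A -> parts_le M A -> U A) ->
  `|\sum_(A : {set 'I_L.+1} | admissible b A && U A) q ^+ weight A
    - rascoe_psum q b M|
  <= distinct_psum `|q| L - distinct_psum `|q| M.
Proof.
move=> leML UM.
rewrite (rascoe_psum_widen _ _ leML) (distinct_psum_widen _ leML).
rewrite (bigID (@parts_le M L.+1)) /= /distinct_psum.
rewrite [X in _ <= X - _](bigID (@parts_le M L.+1)) /=.
rewrite [X in X + _ - _](_ : _ =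
  \sum_(A : {set 'I_L.+1} | admissible b A && parts_le M A) q ^+ weight A).
  rewrite [leRHS]addrAC [X in `|X|]addrAC !subrr !add0r.
  apply: le_trans (ler_norm_sum _ _ _) _.
  rewrite big_mkcond [leRHS]big_mkcond /=; apply: ler_sum => A _.
  rewrite normrX /admissible; case: (ord0 \notin A) => //=.
  have := exprn_ge0 (weight A) (normr_ge0 q).
  by case: (parts_le M A); rewrite ?andbF ?andbT //=; case: ifP.
apply: eq_bigl => A; have [AM|] := boolP (parts_le M A); last by rewrite !andbF.
rewrite !andbT; have [/and3P[A0 _ _]|//] := boolP (admissible b A).
by rewrite UM.
Qed.

(** * Partitions with a given number of parts *)

Lemma bin2D k : ('C(k, 2) + 'C(k, 2) + k = k * k)%N.
Proof. by elim: k => // k IHk; rewrite binS bin1; lia. Qed.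

(* Sum of [n - m] parts below [n], of [n] itself when [b] holds, and of [m - b]
   parts above [n], when these parts are as small as possible. *)
Lemma minimal_weight (b : bool) n m : (b <= m <= n)%N ->
  (n * b + ((n - m) + 'C(n - m, 2)) + (n.+1 * (m - b) + 'C(m - b, 2))
   = 'C(n.+1, 2) + m * (m - b))%N.
Proof.
case/andP=> bm mn; have [k mE] : {k | m = k + b}%N by exists (m - b)%N; lia.
have [p ->] : {p | n = k + b + p}%N by exists (n - m)%N; lia.
rewrite mE addKn addnK {n m bm mn mE}.
move: (bin2D p) (bin2D k) (bin2D (k + b + p).+1).
move: 'C(p, 2) 'C(k, 2) 'C(_.+1, 2) => x y z.
by case: b => /=; nia.
Qed.

Section CardinalityCoefficient.

Variables (F : fieldType) (q : F) (b : bool) (n : nat).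

(* Factor contributed by the potential part [i]; the part [n] is forced when [b]
   holds and forbidden otherwise. *)
Definition part_factor (i : nat) : {poly F} :=
  ((~~ b || (i != n))%:R)%:P
  + (((i != 0%N) && (b || (i != n)))%:R * q ^+ i) *: 'X.

(** The coefficient of [X^n] keeps only sets of [n] elements, for which being Rascoe means
    containing [n]: a condition on a single factor. *)
Lemma coef_prod_part_factor (L : nat) : (0 < n <= L)%N ->
  (\prod_(i < L.+1) part_factor i)`_n = card_psum q b L n.
Proof.
case/andP=> n0 nL.
have [on onE] : exists i : 'I_L.+1, i = n :> nat.
  by exists (inord n); rewrite inordK.
(* With the [X] term first, the expansion runs over the set [A] of indices at which that term is
   chosen. *)
under eq_bigr do rewrite /part_factor addrC.
rewrite bigA_distr coef_sum /card_psum [RHS]big_mkcond /=; apply: eq_bigr => A _.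
have rascoeE : #|A| = n -> is_rascoe A = (on \in A).
  move=> An; apply/exists_inP/idP => [[k kA /eqP kE]|onA]; last first.
    by exists on; rewrite // onE An.
  have -> : on = k by apply: val_inj; rewrite /= onE kE An.
  exact: kA.
have [A0|A0] := boolP (ord0 \in A).
  by rewrite /admissible A0 (bigD1 ord0) // A0 /= mul0r scale0r mul0r coef0.
(* If membership of [n] in [A] disagrees with [b], the term chosen at [n] is zero. *)
have [bA|bA] := eqVneq (on \in A) b; last first.
  rewrite (bigD1 on) //= onE eqxx !orbF.
  rewrite [RHS](_ : _ = 0); last first.
    case: ifP => // /andP[/and3P[_ _ /eqP rA] /eqP /rascoeE rE].
    by case/eqP: bA; rewrite -rE.
  rewrite [X in X * _](_ : _ = 0) ?mul0r ?coef0 //.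
  by case: (on \in A) bA; case: (b) => //= _; rewrite ?andbF ?mul0r ?scale0r.
rewrite (eq_bigr (fun i : 'I_L.+1 => if i \in A then q ^+ i *: 'X else 1));
  last first.
  move=> i _; have [iA|iA] := boolP (i \in A).
    rewrite (part_neq0 A0 iA) /= (_ : b || _) ?mul1r //.
    case: eqVneq => [iE|]; last by rewrite orbT.
    by rewrite -bA (_ : on = i) ?iA //; apply: val_inj; rewrite /= onE.
  rewrite (_ : ~~ b || _) //; case: eqVneq => [iE|]; last by rewrite orbT.
  by rewrite -bA (_ : on = i) ?iA //; apply: val_inj; rewrite /= onE.
rewrite -big_mkcond /= scaler_prod prodr_const -expr_sum -/(weight A) coefZ coefXn.
rewrite /admissible A0 /= eq_sym.
have [An|] := eqVneq #|A| n; last by rewrite andbF mulr0.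
by rewrite andbT An n0 rascoeE // bA eqxx mulr1.
Qed.

Hypothesis q_not_root : forall i, q ^+ i.+1 != 1.

Lemma card_psum_formula (L : nat) : (0 < n <= L)%N ->
  card_psum q b L n
  = q ^+ 'C(n.+1, 2) *
    \sum_(1 <= m < n.+1) gauss_binom q (n - 1) (m - 1) *
      (q ^+ (m * (m - b)) * gauss_binom q (L - n) (m - b)).
Proof.
move=> nL; rewrite -coef_prod_part_factor //; case/andP: nL => n0 nL.
rewrite -(big_mkord xpredT part_factor) big_nat_recl //.
have -> : part_factor 0 = 1.
  by rewrite /part_factor eqxx mul0r scale0r addr0 eq_sym -lt0n n0 orbT.
have PE i : i.+1 != n -> part_factor i.+1 = 1 + q ^+ (i + 1) *: 'X.
  by move=> iE; rewrite /part_factor iE !orbT mul1r addn1.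
(* With index 0 removed, [i] stands for the part [i + 1], so the part [n] sits at index [n.-1]. *)
rewrite mul1r (@big_cat_nat _ _ _ n.-1) //=; last by lia.
rewrite (@big_ltn _ _ _ n.-1) //; last by lia.
rewrite (eq_big_nat _ _ (F2 := fun i => 1 + q ^+ (i + 1) *: 'X)); last first.
  by move=> i /andP[_ iE]; apply: PE; lia.
rewrite (@eq_big_nat _ _ _ n.-1.+1 _ _ (fun i => 1 + q ^+ (i + 1) *: 'X)); last first.
  by move=> i /andP[iE _]; apply: PE; lia.
have -> : \prod_(n.-1.+1 <= i < L) (1 + q ^+ (i + 1) *: 'X)
    = \prod_(0 <= i < L - n) (1 + q ^+ (i + n + 1) *: 'X) :> {poly F}.
  by rewrite prednK // -{1}[n]add0n big_addn.
rewrite prednK //.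
set P := \prod_(0 <= i < n.-1) _; set Q := \prod_(0 <= i < L - n) _.
have PcoefE k : P`_k = q ^+ (1 * k + 'C(k, 2)) * gauss_binom q n.-1 k.
  exact: coef_prod_1Dqexp.
have QcoefE k : Q`_k = q ^+ (n.+1 * k + 'C(k, 2)) * gauss_binom q (L - n) k.
  rewrite -coef_prod_1Dqexp //.
  by under [in RHS]eq_bigr do rewrite addnS -addn1.
have fnE : part_factor n = if b then q ^+ n *: 'X else 1.
  rewrite /part_factor eqxx !orbF andbC; case: (b) => /=.
    by rewrite -lt0n n0 mul1r polyC0 add0r.
  by rewrite mul0r scale0r addr0.
(* Cauchy product of smaller and larger parts; when [b] holds, the part [n] uses up one [X], leaving
   the coefficient of [X^(n-1)]. *)
rewrite fnE; transitivity (q ^+ (n * b) *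
    \sum_(b <= m < n.+1) P`_(n - m) * Q`_(m - b)).
  case: (b) => /=.
    rewrite muln1 -scalerAl -scalerAr coefZ; congr (_ * _).
    rewrite mulrCA coefXM gtn_eqF // coefMr big_add1 prednK // big_mkord.
    by apply: eq_bigr => j _; rewrite subn1 (_ : n.-1 - j = n - j.+1)%N //; lia.
  rewrite muln0 expr0 !mul1r coefMr big_mkord.
  by apply: eq_bigr => j _; rewrite subn0.
rewrite [X in _ * X](_ : _ = \sum_(1 <= m < n.+1) P`_(n - m) * Q`_(m - b)).
  rewrite !mulr_sumr; apply: eq_big_nat => m /andP[m0 mn].
  rewrite PcoefE QcoefE mul1n.
  have -> : gauss_binom q n.-1 (n - m) = gauss_binom q (n - 1) (m - 1).
    rewrite -(gauss_binomC _ (_ : m - 1 <= n - 1)%N); last by lia.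
    by congr gauss_binom; lia.
  have E : q ^+ (n * b) * q ^+ (n - m + 'C(n - m, 2))
        * q ^+ (n.+1 * (m - b) + 'C(m - b, 2))
      = q ^+ 'C(n.+1, 2) * q ^+ (m * (m - b)).
    by rewrite -!exprD minimal_weight //; case: (b); lia.
  transitivity (gauss_binom q (n - 1) (m - 1) * gauss_binom q (L - n) (m - b)
                * (q ^+ 'C(n.+1, 2) * q ^+ (m * (m - b)))); first rewrite -E.
    rewrite [RHS]mulrC -!mulrA; congr (_ * (_ * _)).
    by rewrite mulrCA; congr (_ * _); rewrite mulrC mulrA [in RHS]mulrC.
  by rewrite mulrC -!mulrA; congr (_ * _); rewrite mulrCA [X in _ * X]mulrC.
case: (b) => //.
(* The extra term [m = 0] would need [n] parts below [n], and its Gaussian polynomial vanishes. *)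
rewrite big_ltn // subn0 PcoefE gauss_binom_small ?mulr0 ?mul0r ?add0r //; lia.
Qed.

End CardinalityCoefficient.

(** * Limits *)

Section ComplexLimits.

Local Open Scope classical_set_scope.

Variable R : realType.
(* [R[i]] carries a topology only through its [numFieldType] structure. *)
Notation C := (R[i] : numFieldType).
Implicit Types (z : R[i]) (r : R).

Lemma normc_real r : `|r%:C%C| = `|r|%:C%C :> R[i].
Proof. by rewrite normc_def /= expr0n /= addr0 sqrtr_sqr. Qed.

Lemma normc_exreal z : exists2 r, 0 <= r & `|z| = r%:C%C.
Proof.
rewrite normc_def; set x := Num.sqrt _.
by exists x; rewrite // sqrtr_ge0.
Qed.

Lemma normc_ge_Im z : `|complex.Im z|%:C%C <= `|z|.
Proof.
by rewrite normc_def lecR -sqrtr_sqr ler_wsqrtr // lerDr sqr_ge0.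
Qed.

Lemma normc_le_ReIm z : `|z| <= (`|complex.Re z| + `|complex.Im z|)%:C%C.
Proof.
rewrite {1}[z]complexE rmorphD /=; apply: le_trans (ler_normD _ _) _.
by rewrite normrM !normc_real normc_def /= expr0n /= add0r expr1n sqrtr1 mul1r.
Qed.

Lemma gt0_complex_real z : 0 < z -> exists2 r, 0 < r & z = r%:C%C.
Proof.
by case: z => a b; rewrite ltcE /= => /andP[/eqP-> a0]; exists a.
Qed.

(* The tail bound [G - g K] serves twice: it makes [u] a Cauchy sequence, and it
   forces any sequence [v] with the same tail bound to the limit of [u]. *)
Lemma cvg_complex_tail (u : nat -> C) (g : nat -> R) (G : R) :
  g @ \oo --> G ->
  (forall K L, (K <= L)%N -> `|u L - u K| <= (G - g K)%:C%C) ->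
  exists s : C, forall v : nat -> C,
    (forall K, \forall M \near \oo, `|v M - u K| <= (G - g K)%:C%C) ->
    v @ \oo --> s.
Proof.
move=> gG uB.
have small (e : R) : 0 < e -> exists K, G - g K <= e.
  move=> e0; have /cvgrPdist_le/(_ e e0) [K _ /(_ K (leqnn K)) /= GK] := gG.
  by exists K; apply: le_trans GK; rewrite ler_norm.
(* Completeness of [R], to be applied to the real and imaginary parts separately. *)
have real_cvg (w : nat -> R) :
    (forall K L, (K <= L)%N -> `|w L - w K| <= G - g K) ->
    exists l : R, forall K, `|l - w K| <= G - g K.
  move=> wB; have : cvgn w.
    apply: cauchy_cvg; apply: cauchy_exP => e e0.
    have [K GK] := small (e / 2) (divr_gt0 e0 (ltr0Sn _ _)).
    exists (w K), K => // L /= KL; rewrite /ball /= distrC.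
    apply: le_lt_trans (wB _ _ KL) _; apply: le_lt_trans GK _.
    by rewrite ltr_pdivrMr // ltr_pMr // ltr1n.
  move=> wl; exists (limn w) => K.
  have wlK : (fun L => `|w L - w K|) @ \oo --> `|limn w - w K|.
    by apply: cvg_norm; apply: cvgB => //; apply: cvg_cst.
  by apply: (cvgr_to_le wlK); exists K => // L /= KL; apply: wB.
have [|a aB] := real_cvg (fun n => complex.Re (u n)).
  move=> K L KL; rewrite -lecR; apply: le_trans (uB _ _ KL).
  by case: (u L) (u K) => [? ?] [? ?]; exact: normc_ge_Re (_ +i* _)%C.
have [|b bB] := real_cvg (fun n => complex.Im (u n)).
  move=> K L KL; rewrite -lecR; apply: le_trans (uB _ _ KL).
  by case: (u L) (u K) => [? ?] [? ?]; exact: normc_ge_Im (_ +i* _)%C.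
exists ((a +i* b)%C : C) => v vB.
apply/cvgrPdist_le => _ /gt0_complex_real[e e0 ->].
(* One third each for the real part of the limit, its imaginary part, and [v M], all compared with
   [u K]. *)
have [K GK] := small (e / 3) (divr_gt0 e0 (ltr0Sn _ _)).
near=> M.
have -> : ((a +i* b)%C : C) - v M = ((a +i* b)%C - u K) - (v M - u K) by ring.
apply: le_trans (ler_normB _ _) _.
have -> : e = (e / 3 + e / 3) + e / 3 by field.
rewrite rmorphD /=; apply: lerD.
  apply: le_trans (normc_le_ReIm _) _.
  rewrite lecR; move: (aB K) (bB K).
  case: (u K) => c d /= ac bd.
  by apply: lerD; [apply: le_trans ac _ | apply: le_trans bd _].
by apply: le_trans (_ : (G - g K)%:C%C <= _); [near: M; exact: vB | rewrite lecR].
Unshelve. all: end_near.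
Qed.

Lemma cvg_normc_le (v : nat -> C) (l z : C) r :
  v @ \oo --> l -> (\forall L \near \oo, `|v L - z| <= r%:C%C) ->
  `|l - z| <= r%:C%C.
Proof.
have [x _ xE] := normc_exreal (l - z).
move=> vl vr; rewrite xE lecR; apply/ler_addgt0Pl => e e0.
rewrite -lecR rmorphD /= -xE.
move/cvgrPdist_le/(_ e%:C%C): vl; rewrite ltcR => /(_ e0) vl.
near \oo => L.
have -> : l - z = (l - v L) + (v L - z) by ring.
by apply: le_trans (ler_normD _ _) _; apply: lerD; near: L.
Unshelve. all: end_near.
Qed.

Lemma cvg_expc (q : R[i]) :
  `|q| < 1 -> (fun L => q ^+ L : C) @ \oo --> (0 : C).
Proof.
have [x x0 qx] := normc_exreal q.
rewrite qx (ltcR x 1) => x1.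
apply/cvgrPdist_le => _ /gt0_complex_real[e e0 ->].
have : `|x| < 1 by rewrite ger0_norm.
move/cvg_expr/cvgrPdist_le/(_ e e0); apply: filterS => L.
rewrite !sub0r !normrN => xL; change (`|q ^+ L : R[i]| <= e%:C%C).
by rewrite normrX qx -rmorphXn lecR; apply: le_trans xL; apply: ler_norm.
Qed.

End ComplexLimits.

(** By [rascoe_psum_dist] the difference bounds a norm, hence is nonnegative. *)
Lemma distinct_psum_homo (K : numFieldType) (x : K) : 0 <= x ->
  {homo distinct_psum x : M L / (M <= L)%N >-> M <= L}.
Proof.
move=> x0 M L leML; rewrite -subr_ge0 -{1 2}(ger0_norm x0).
by apply: le_trans (@rascoe_psum_dist _ x true _ _ xpredT leML _) => //.
Qed.

(** Monotone and bounded: [1 + x^(i+1) <= exp (x^i)], and the exponents form a geometric series with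
    sum [1 / (1 - x)]. *)
Lemma distinct_psum_cvg (R : realType) (x : R) : 0 <= x < 1 ->
  cvgn (distinct_psum x).
Proof.
case/andP=> x0 x1; apply: nondecreasing_is_cvgn; first exact: distinct_psum_homo.
exists (expR (1 - x)^-1) => _ [N _ <-]; rewrite distinct_psum_prod.
apply: (@le_trans _ _ (\prod_(i < N) expR (x ^+ i))).
  apply: ler_prod => i _; rewrite addr_ge0 ?exprn_ge0 //=.
  apply: le_trans (expR_ge1Dx _); rewrite lerD2l exprS.
  by rewrite ler_piMl ?exprn_ge0 // ltW.
rewrite -expR_sum ler_expR -[leRHS]mul1r ler_pdivlMr ?subr_gt0 //.
rewrite [leLHS](_ : _ = 1 - x ^+ N); first by rewrite gerBl exprn_ge0.
by rewrite mulrC -(opprB x 1) mulNr -subrX1 opprB.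
Qed.

(** * Limits of Gaussian polynomials *)

Section GaussLimit.

Local Open Scope classical_set_scope.

Variables (K : numFieldType) (q : K).
Hypothesis q_not_root : forall i, q ^+ i.+1 != 1.
Hypothesis q_cvg0 : (fun L => q ^+ L) @ \oo --> 0.

(** Isolates the dependence on [L] in one numerator, which tends to 1; the limit then follows by
    induction on [r]. *)
Lemma gauss_binom_recr L r : (r <= L)%N ->
  gauss_binom q L r.+1
  = gauss_binom q L r * ((1 - q ^+ (L - r)) / (1 - q ^+ r.+1)).
Proof.
rewrite leq_eqVlt => /predU1P[->|ltrL].
  by rewrite gauss_binom_small // subnn expr0 subrr mul0r mulr0.
have [p ->] : {p | L = r + p.+1}%N by exists (L - r.+1)%N; lia.
rewrite /gauss_binom leq_addr -addSnnS leq_addr addSnnS addKn -addSnnS addKn.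
rewrite !qpochS -!exprS.
have nz i : 1 - q ^+ i.+1 != 0 by rewrite subr_eq0 eq_sym.
move: (nz r) (nz p) (qpoch_neq0 q_not_root r) (qpoch_neq0 q_not_root p).
move: (q ^+ r.+1) (q ^+ p.+1) => u v *.
by field; repeat (apply/andP; split).
Qed.

Lemma gauss_binom_cvg r :
  (fun L => gauss_binom q L r) @ \oo --> (qpoch q q r)^-1.
Proof.
elim: r => [|r IHr].
  rewrite qpoch0 invr1; under eq_fun do rewrite gauss_binom0 //.
  exact: cvg_cst.
have near_rec : {near \oo,
    (fun L => gauss_binom q L r * ((1 - q ^+ (L - r)) / (1 - q ^+ r.+1)))
    =1 (fun L => gauss_binom q L r.+1)}.
  by exists r => // L /= rL; rewrite gauss_binom_recr.
apply: cvg_trans (near_eq_cvg near_rec) _.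
have -> : (qpoch q q r.+1)^-1 = (qpoch q q r)^-1 * (1 * (1 - q ^+ r.+1)^-1).
  by rewrite qpochS -exprS invfM mul1r.
apply: cvgM => //.
apply: (@cvgM _ _ _ _ (fun L => 1 - q ^+ (L - r)) (fun=> (1 - q ^+ r.+1)^-1));
  last exact: cvg_cst.
rewrite -[X in _ --> X](subr0 1).
apply: cvgB; first exact: cvg_cst.
by have := q_cvg0; rewrite -(cvg_centern r).
Qed.

Lemma card_psum_cvg (b : bool) n : (0 < n)%N ->
  card_psum q b ^~ n @ \oo -->
  q ^+ (n * (n + 1) %/ 2) *
    \sum_(1 <= m < n.+1) gauss_binom q (n - 1) (m - 1) *
      (q ^+ (m * (m - b)) / qpoch q q (m - b)).
Proof.
move=> n0; have near_formula : {near \oo, (fun L => q ^+ 'C(n.+1, 2) *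
    \sum_(1 <= m < n.+1) gauss_binom q (n - 1) (m - 1) *
    (q ^+ (m * (m - b)) * gauss_binom q (L - n) (m - b))) =1 card_psum q b ^~ n}.
  by exists n => // L /= nL; rewrite -card_psum_formula // n0.
apply: cvg_trans (near_eq_cvg near_formula) _.
rewrite (_ : n * (n + 1) %/ 2 = 'C(n.+1, 2))%N; last first.
  by rewrite bin2 divn2 addn1 mulnC.
apply: cvgMl_tmp; apply: (@cvg_big _ _ +%R); first exact: add_continuous.
move=> m _; do 2 apply: cvgMl_tmp.
by have := @gauss_binom_cvg (m - b); rewrite -(cvg_centern n).
Qed.

End GaussLimit.

Lemma eq_sums_from1_to (K : numFieldType) (f g : nat -> K) (s : K) :
  (forall n, (0 < n)%N -> f n = g n) -> sums_from1_to f s -> sums_from1_to g s.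
Proof.
move=> fg; rewrite /sums_from1_to.
rewrite (_ : (fun M => \sum_(1 <= n < M.+1) g n)
           = (fun M => \sum_(1 <= n < M.+1) f n)) //.
by apply/funext => M; apply: eq_big_nat => n /andP[n0 _]; rewrite fg.
Qed.

(** * Comparison of the two series *)

Section Limit.

Local Open Scope classical_set_scope.

Variables (R : realType) (q : R[i]).
Hypothesis hq : `|q| < 1.
Notation C := (R[i] : numFieldType).

(** Both identities at once: [b] read as 1 or 0 turns [m - b] into [m - 1] or [m]. *)
Lemma rascoe_series (b : bool) : exists s : R[i],
  sums_from1_to (fun N => (num_parts b N)%:R * q ^+ N) s /\
  sums_from1_to (fun n => q ^+ (n * (n + 1) %/ 2) *
    \sum_(1 <= m < n.+1) gauss_binom q (n - 1) (m - 1) *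
      (q ^+ (m * (m - b)) / qpoch q q (m - b))) s.
Proof.
have q_not_root i : q ^+ i.+1 != 1.
  have : `|q| ^+ i.+1 < 1 by rewrite exprn_ilt1.
  by apply: contraTneq => qi; rewrite -normrX qi normr1 ltxx.
have [x x0 qx] := normc_exreal q.
have x1 : x < 1 by have := hq; rewrite qx (ltcR x 1).
have gc M : distinct_psum `|q| M = (distinct_psum x M)%:C%C.
  by rewrite qx /distinct_psum rmorph_sum; apply: eq_bigr => A _; rewrite rmorphXn.
have gG : cvgn (distinct_psum x) by apply: distinct_psum_cvg; rewrite x0.
set G := limn (distinct_psum x) in gG.
have bound M L (U : pred {set 'I_L.+1}) : (M <= L)%N ->
    (forall A : {set 'I_L.+1}, ord0 \notin A -> parts_le M A -> U A) ->
    `|\sum_(A : {set 'I_L.+1} | admissible b A && U A) q ^+ weight A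
      - rascoe_psum q b M| <= (G - distinct_psum x M)%:C%C.
  move=> ML UM; apply: le_trans (rascoe_psum_dist q b ML UM) _.
  rewrite !gc -rmorphB lecR lerD2r.
  by apply: nondecreasing_cvgn_le => //; apply: distinct_psum_homo.
have [|s sP] := @cvg_complex_tail R (rascoe_psum q b) _ _ gG.
  move=> M L ML; have := bound M L xpredT ML (fun _ _ _ => isT).
  by under eq_bigl do rewrite andbT.
exists s; split; apply: sP => M.
  (* This threshold gives [M <= L] and also [weight A <= L] for every set of parts up to [M]. *)
  exists (M + M * M)%N => // L /= ML; rewrite num_parts_psum.
  apply: bound => [|A A0 AM]; first by lia.
  by apply: leq_trans (weight_parts_le _ A0 AM) _; lia.
exists M => // N /= MN.
(* For fixed [N] the partial sum is a limit as the bound [L] on the parts grows; the estimate is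
   uniform in [L], so it passes to the limit. *)
apply: (@cvg_normc_le R (fun L => \sum_(1 <= n < N.+1) card_psum q b L n : C)).
  rewrite big_nat_cond; under eq_fun do rewrite big_nat_cond.
  apply: (@cvg_big C nat (@GRing.add C) 0); first exact: add_continuous.
  move=> n /andP[/andP[n0 _] _].
  by have := @card_psum_cvg C q q_not_root (cvg_expc hq) b n n0.
exists N => // L /= NL; rewrite card_psum_sum; apply: bound; first by lia.
move=> A A0 AM; exact: leq_trans (card_parts_le (leq_trans MN NL) A0 AM) MN.
Qed.

End Limit.

Theorem theorem2p2 (R : realType) (q : R[i]) (hq : `|q| < 1) :
  (exists s : R[i],
     sums_from1_to (fun N => (num_rascoe N)%:R * q ^+ N) s /\
     sums_from1_to (fun n =>
       q ^+ (n * (n + 1) %/ 2) *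
       \sum_(1 <= m < n.+1)
         gauss_binom q (n - 1) (m - 1) *
         (q ^+ (m * (m - 1)) / qpoch q q (m - 1))) s)
  /\
  (exists s : R[i],
     sums_from1_to (fun N => (num_nonrascoe N)%:R * q ^+ N) s /\
     sums_from1_to (fun n =>
       q ^+ (n * (n + 1) %/ 2) *
       \sum_(1 <= m < n.+1)
         gauss_binom q (n - 1) (m - 1) *
         (q ^+ (m ^ 2) / qpoch q q m)) s).
Proof.
split.
  have [s [num_s gf_s]] := rascoe_series hq true.
  exists s; split => //; apply: eq_sums_from1_to num_s => N _.
  by congr (_%:R * _); apply: eq_card => A; rewrite !inE eqb_id.
have [s [num_s gf_s]] := rascoe_series hq false.
exists s; split.
  apply: eq_sums_from1_to num_s => N _.
  by congr (_%:R * _); apply: eq_card => A; rewrite !inE eqbF_neg.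
apply: eq_sums_from1_to gf_s => n _; congr (_ * _).
by apply: eq_bigr => m _; rewrite subn0 mulnn.
Qed.
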